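(* Let $\Lambda$ be a good ordered commutative monoid, and let $G_*$ and $K_*$ be $\Lambda$-filtered groups such that $G_*$ acts on $K_*$. For each $\lambda\in\Lambda_+$ there is a homomorphism $$\tau_\lambda\colon G_\lambda\longrightarrow \mathrm{Der}_\lambda(\bar K)$$ which maps each $g\in G_\lambda$ to $\tau_\lambda(g)=\big(\tau_\lambda(g)_\mu\colon\bar K_\mu\to\bar K_{\lambda+\mu}\big)_{\mu\in\Lambda_+}$ defined by $\tau_\lambda(g)_\mu([a]_\mu)=[[g,a]]_{\lambda+\mu}$ for $a\in K_\mu$.
   Context: An ordered commutative monoid is a commutative monoid $(\Lambda,+,0)$ with a partial order $\le$ such that $\lambda\le\lambda'$ implies $\lambda+\mu\le\lambda'+\mu$. It is good if $0\le\lambda$ for all $\lambda\in\Lambda$ and if $\lambda<\lambda'$ implies $\lambda+\mu<\lambda'+\mu$. Put $\Lambda_+=\Lambda\setminus\{0\}$. A $\Lambda$-filtration of a group $K$ is a family $K_*=(K_\lambda)_{\lambda\in\Lambda}$ of normal subgroups of $K$ such that $K_0=K$, $K_\lambda\supset K_\mu$ whenever $\lambda\le\mu$, and $[K_\lambda,K_\mu]\subset K_{\lambda+\mu}$ for all $\lambda,\mu\in\Lambda$ (with $[a,b]=aba^{-1}b^{-1}$). A $\Lambda$-filtered group is a group with a $\Lambda$-filtration. $K_{>\lambda}$ is the (normal) subgroup generated by $\bigcup_{\mu>\lambda}K_\mu$, $\bar K_\lambda=K_\lambda/K_{>\lambda}$, and $[a]_\lambda=aK_{>\lambda}$ for $a\in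 K_\lambda$. $\bar K=\bigoplus_{\lambda\in\Lambda_+}\bar K_\lambda$ is a $\Lambda_+$-graded Lie algebra over $\mathbb Z$ with bracket $[[a]_\lambda,[b]_\mu]=[[a,b]]_{\lambda+\mu}$. If a group $G$ acts on a group $K$, both are regarded as subgroups of $K\rtimes G$, so $[g,k]=g(k)k^{-1}\in K$ for $g\in G$, $k\in K$. A $\Lambda$-filtered group $G_*$ (with $G_0$ acting on $K_0$) acts on $K_*$ if $[G_\lambda,K_\mu]\subset K_{\lambda+\mu}$ for all $\lambda,\mu\in\Lambda$. For a $\Lambda_+$-graded Lie algebra $L$ and $\lambda\in\Lambda_+$, $\mathrm{Der}_\lambda(L)$ is the abelian group of derivations $d\colon L\to L$ (i.e. $\mathbb Z$-linear maps with $d([x,y])=[d(x),y]+[x,d(y)]$) of degree $\lambda$, i.e. $d(L_\mu)\subset L_{\lambda+\mu}$ for all $\mu\in\Lambda_+$. *)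

(* Defs.v *)
From HB Require Import structures.
From mathcomp Require Import all_boot all_algebra.
From mathcomp Require Import all_classical.

Set Implicit Arguments.
Unset Strict Implicit.
Unset Printing Implicit Defensive.

Import GRing.Theory.
Local Open Scope classical_set_scope.
Local Open Scope ring_scope.

(* MathComp's own join of [porderType] and [zmodType] prevents a join of      *)
(* [porderType] and [nmodType], whence an order bundled in the mixin.         *)
HB.mixin Record Nmodule_isOrdered T of GRing.Nmodule T := {
  ole : rel T;
  ole_refl : reflexive ole;
  ole_anti : antisymmetric ole;
  ole_trans : transitive ole;
  oleD2r : forall x y z : T, ole x y -> ole (x + z) (y + z)
}.

#[short(type="orderedMonoidType")]
HB.structure Definition OrderedMonoid :=
  { T of GRing.Nmodule T & Nmodule_isOrdered T }.

Definition olt {T : orderedMonoidType} : rel T :=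
  fun x y => (x != y) && ole x y.

HB.mixin Record OrderedMonoid_isGood T of OrderedMonoid T := {
  ole0x : forall x : T, ole 0 x;
  oltD2r : forall x y z : T, olt x y -> olt (x + z) (y + z)
}.

#[short(type="goodMonoidType")]
HB.structure Definition GoodMonoid :=
  { T of OrderedMonoid T & OrderedMonoid_isGood T }.

Section Positive.
Context {Lam : goodMonoidType}.

Definition pos := {l : Lam | l != 0}.

Lemma pos_gt0 (l : pos) : olt 0 (val l).
Proof. by rewrite /olt eq_sym (valP l) ole0x. Qed.

Lemma posD_subproof (l m : pos) : val l + val m != 0.
Proof.
have /andP[ne le] := oltD2r 0 (val l) (val m) (pos_gt0 l).
rewrite add0r in ne le; apply: contraNneq ne => lm0.
rewrite lm0 in le *; apply/eqP/ole_anti.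
by rewrite le ole0x.
Qed.

Definition posD (l m : pos) : pos := Sub (val l + val m) (posD_subproof l m).

Lemma posDC : commutative posD.
Proof. by move=> l m; apply: val_inj; rewrite /= addrC. Qed.

Lemma posDA : associative posD.
Proof. by move=> l m n; apply: val_inj; rewrite /= addrA. Qed.

End Positive.
Arguments pos Lam : clear implicits.

Section DirectSum.
Context {I : choiceType} (M : I -> zmodType).

Record dsum := DSum {
  dsum_val :> forall i, M i;
  dsum_finite : finite_set [set i | dsum_val i != 0]
}.

HB.instance Definition _ := gen_eqMixin dsum.
HB.instance Definition _ := gen_choiceMixin dsum.

Lemma dsumP (f g : dsum) : (forall i, f i = g i) -> f = g.
Proof.
case: f g => [f Pf] [g Pg] /= fg.
have {}fg : f = g by apply: functional_extensionality_dep.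
by subst g; congr DSum; exact: Prop_irrelevance.
Qed.

Lemma dsum0_subproof : finite_set [set i | (0 : M i) != 0].
Proof.
by rewrite (_ : mkset _ = set0)// -subset0 => i /=; rewrite eqxx.
Qed.

Lemma dsumN_subproof (f : dsum) : finite_set [set i | - f i != 0].
Proof.
by apply: sub_finite_set (dsum_finite f) => i /=; rewrite oppr_eq0.
Qed.

Lemma dsumD_subproof (f g : dsum) : finite_set [set i | f i + g i != 0].
Proof.
have fin : finite_set ([set i | f i != 0] `|` [set i | g i != 0]).
  by rewrite finite_setU; split; exact: dsum_finite.
apply: sub_finite_set fin => i /= fg.
have [fi|] := eqVneq (f i) 0; last by left.
by right; rewrite fi add0r in fg.
Qed.

Definition dsum0 := DSum dsum0_subproof.
Definition dsumN f := DSum (dsumN_subproof f).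
Definition dsumD f g := DSum (dsumD_subproof f g).

Lemma dsumDA : associative dsumD.
Proof. by move=> f g h; apply: dsumP => i /=; rewrite addrA. Qed.
Lemma dsumDC : commutative dsumD.
Proof. by move=> f g; apply: dsumP => i /=; rewrite addrC. Qed.
Lemma dsum0D : left_id dsum0 dsumD.
Proof. by move=> f; apply: dsumP => i /=; rewrite add0r. Qed.
Lemma dsumND : left_inverse dsum0 dsumN dsumD.
Proof. by move=> f; apply: dsumP => i /=; rewrite addNr. Qed.

HB.instance Definition _ :=
  GRing.isZmodule.Build dsum dsumDA dsumDC dsum0D dsumND.

Lemma dsum_in_subproof i (x : M i) :
  finite_set [set j | eqtype.dfwith (T := M) (fun=> 0) x j != 0].
Proof.
apply: sub_finite_set (finite_set1 i) => j /=.
by case: eqtype.dfwithP => // k; rewrite eqxx.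
Qed.

Definition dsum_in i (x : M i) : dsum := DSum (dsum_in_subproof x).

Lemma dsum_inE i (x : M i) : dsum_in x i = x.
Proof. exact: eqtype.dfwith_in. Qed.

Lemma dsum_in_out i (x : M i) j : i != j -> dsum_in x j = 0.
Proof. exact: eqtype.dfwith_out. Qed.

Lemma dsum_in_additive i : zmod_morphism (@dsum_in i).
Proof.
move=> x y; apply: dsumP => j /=.
have [ij|ij] := eqVneq i j; last by rewrite !eqtype.dfwith_out// addrN.
by case: _ / ij; rewrite !eqtype.dfwith_in.
Qed.

HB.instance Definition _ i := GRing.isZmodMorphism.Build (M i) dsum (@dsum_in i)
  (@dsum_in_additive i).

Lemma dsum_sum (f : dsum) (s : seq I) : uniq s ->
  (forall i, f i != 0 -> i \in s) -> f = \sum_(i <- s) dsum_in (f i).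
Proof.
move=> us sf; apply: dsumP => j.
have E (F : I -> dsum) r : (\sum_(i <- r) F i : dsum) j = \sum_(i <- r) F i j.
  by elim: r => [|i r IH]; rewrite ?big_nil// !big_cons -IH.
rewrite E; have [js|js] := boolP (j \in s).
  rewrite (bigD1_seq j)//= eqtype.dfwith_in big1 ?addr0// => i ij.
  by rewrite eqtype.dfwith_out.
rewrite big_seq big1 => [|i si]; first by apply: contraNeq js; exact: sf.
by rewrite /= eqtype.dfwith_out//; apply: contraNneq js => <-.
Qed.

Lemma dsum_ind (P : dsum -> Prop) : P 0 -> (forall f g, P f -> P g -> P (f + g)) ->
  (forall i (x : M i), P (dsum_in x)) -> forall f, P f.
Proof.
move=> P0 PD Pin f.
have fin := dsum_finite f.
rewrite (@dsum_sum f (finmap.enum_fset (fset_set [set i | f i != 0]))) ?finmap.fset_uniq//.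
  by elim/big_ind: _ => // i _; exact: Pin.
by move=> i fi; rewrite in_fset_set// inE.
Qed.

End DirectSum.

Section GradedLie.
Context {Lam : goodMonoidType}.

(* The bracket is given on homogeneous elements; antisymmetry and the Jacobi *)
(* identity relate terms lying in [L (l + m)] and [L (m + l)], etc., and are *)
(* therefore stated in the direct sum.                                       *)
Record gradedLie := GradedLie {
  glie_sort :> pos Lam -> zmodType;
  glie_br : forall l m, glie_sort l -> glie_sort m -> glie_sort (posD l m);
  glie_brDl : forall l m (x x' : glie_sort l) (y : glie_sort m),
    glie_br (x + x') y = glie_br x y + glie_br x' y;
  glie_brDr : forall l m (x : glie_sort l) (y y' : glie_sort m),
    glie_br x (y + y') = glie_br x y + glie_br x y';
  glie_brxx : forall l (x : glie_sort l), glie_br x x = 0;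
  glie_brC : forall l m (x : glie_sort l) (y : glie_sort m),
    dsum_in (glie_br x y) = - dsum_in (glie_br y x);
  glie_jacobi : forall l m n
      (x : glie_sort l) (y : glie_sort m) (z : glie_sort n),
    dsum_in (glie_br (glie_br x y) z) + dsum_in (glie_br (glie_br y z) x)
      + dsum_in (glie_br (glie_br z x) y) = 0
}.

Context (L : gradedLie).

Lemma glie_br0l l m (y : L m) : glie_br (0 : L l) y = 0.
Proof. by apply: (addIr (glie_br 0 y)); rewrite -glie_brDl !add0r. Qed.

Lemma glie_br0r l m (x : L l) : glie_br x (0 : L m) = 0.
Proof. by apply: (addIr (glie_br x 0)); rewrite -glie_brDr !add0r. Qed.

(* The bilinear extension to the total Lie algebra; see [lie_br_in] and      *)
(* [lie_brDl], ..., [lie_jacobi].                                            *)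
Definition lie_br (f g : dsum L) : dsum L :=
  \sum_(i \in [set i | f i != 0]) \sum_(j \in [set j | g j != 0])
    dsum_in (glie_br (f i) (g j)).

Lemma lie_brE (f g : dsum L) (s t : seq (pos Lam)) : uniq s -> uniq t ->
  (forall i, f i != 0 -> i \in s) -> (forall j, g j != 0 -> j \in t) ->
  lie_br f g = \sum_(i <- s) \sum_(j <- t) dsum_in (glie_br (f i) (g j)).
Proof.
move=> us ut sf tg.
have aux (h : dsum L) (r : seq (pos Lam)) (F : pos Lam -> dsum L) : uniq r ->
    (forall i, h i != 0 -> i \in r) -> (forall i, h i = 0 -> F i = 0) ->
    \sum_(i \in [set i | h i != 0]) F i = \sum_(i <- r) F i.
  move=> ur hr F0; transitivity (\sum_(i <- r | h i != 0) F i).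
    by rewrite (bigfs _ ur)// => i hi; rewrite hr.
  rewrite big_mkcond/=; apply: eq_bigr => i _.
  by have [/F0 ->|//] := eqVneq (h i) 0.
rewrite /lie_br (aux f s)// => [|i fi]; last first.
  by rewrite fi; apply: fsbig1 => j _; rewrite glie_br0l raddf0.
apply: eq_bigr => i _; rewrite (aux g t)// => j ->.
by rewrite glie_br0r raddf0.
Qed.

Lemma lie_br_in l m (x : L l) (y : L m) :
  lie_br (dsum_in x) (dsum_in y) = dsum_in (glie_br x y).
Proof.
have P k (z : L k) i : dsum_in z i != 0 -> i \in [:: k].
  rewrite inE; apply: contra_neqT => ik.
  by rewrite dsum_in_out// eq_sym.
by rewrite (@lie_brE _ _ [:: l] [:: m]) ?big_seq1 ?dsum_inE//; exact: P.
Qed.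

Lemma lie_brDl : left_distributive lie_br +%R.
Proof.
move=> f g h.
have ff := dsum_finite f; have fg := dsum_finite g; have fh := dsum_finite h.
have ffg : finite_set ([set i | f i != 0] `|` [set i | g i != 0]).
  by rewrite finite_setU.
set s := finmap.enum_fset (fset_set ([set i | f i != 0] `|` [set i | g i != 0])).
set t := finmap.enum_fset (fset_set [set i | h i != 0]).
have fs i : f i != 0 -> i \in s by rewrite /= in_fset_set// inE; left.
have gs i : g i != 0 -> i \in s by rewrite /= in_fset_set// inE; right.
have ht i : h i != 0 -> i \in t by rewrite /= in_fset_set// inE.
have fgs i : (f + g) i != 0 -> i \in s.
  apply: contraNT => si; have -> : (f + g) i = f i + g i by [].
  have /eqP -> : f i == 0 by apply: contraNT si; exact: fs.
  have /eqP -> : g i == 0 by apply: contraNT si; exact: gs.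
  by rewrite addr0.
rewrite !(@lie_brE _ _ s t) ?finmap.fset_uniq// -big_split/=; apply: eq_bigr => i _.
by rewrite -big_split/=; apply: eq_bigr => j _; rewrite glie_brDl raddfD.
Qed.

Lemma lie_brDr : right_distributive lie_br +%R.
Proof.
move=> h f g.
have ff := dsum_finite f; have fg := dsum_finite g; have fh := dsum_finite h.
have ffg : finite_set ([set i | f i != 0] `|` [set i | g i != 0]).
  by rewrite finite_setU.
set s := finmap.enum_fset (fset_set ([set i | f i != 0] `|` [set i | g i != 0])).
set t := finmap.enum_fset (fset_set [set i | h i != 0]).
have fs i : f i != 0 -> i \in s by rewrite /= in_fset_set// inE; left.
have gs i : g i != 0 -> i \in s by rewrite /= in_fset_set// inE; right.
have ht i : h i != 0 -> i \in t by rewrite /= in_fset_set// inE.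
have fgs i : (f + g) i != 0 -> i \in s.
  apply: contraNT => si; have -> : (f + g) i = f i + g i by [].
  have /eqP -> : f i == 0 by apply: contraNT si; exact: fs.
  have /eqP -> : g i == 0 by apply: contraNT si; exact: gs.
  by rewrite addr0.
rewrite !(@lie_brE _ _ t s) ?finmap.fset_uniq// -big_split/=; apply: eq_bigr => i _.
by rewrite -big_split/=; apply: eq_bigr => j _; rewrite glie_brDr raddfD.
Qed.

Lemma lie_br0l f : lie_br 0 f = 0.
Proof. by apply: (addIr (lie_br 0 f)); rewrite -lie_brDl !add0r. Qed.

Lemma lie_br0r f : lie_br f 0 = 0.
Proof. by apply: (addIr (lie_br f 0)); rewrite -lie_brDr !add0r. Qed.

Lemma lie_brC f g : lie_br f g = - lie_br g f.
Proof.
elim/(@dsum_ind _ L): f => [|f f' IH IH'|i x]; first by rewrite lie_br0l lie_br0r oppr0.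
  by rewrite lie_brDl lie_brDr IH IH' opprD.
elim/(@dsum_ind _ L): g => [|g g' IH IH'|j y]; first by rewrite lie_br0l lie_br0r oppr0.
  by rewrite lie_brDl lie_brDr IH IH' opprD.
by rewrite !lie_br_in glie_brC.
Qed.

Lemma lie_brxx f : lie_br f f = 0.
Proof.
elim/(@dsum_ind _ L): f => [|f g IHf IHg|i x]; first by rewrite lie_br0l.
  by rewrite lie_brDl !lie_brDr IHf IHg add0r addr0 lie_brC addNr.
by rewrite lie_br_in glie_brxx raddf0.
Qed.

Lemma lie_jacobi f g h :
  lie_br (lie_br f g) h + lie_br (lie_br g h) f + lie_br (lie_br h f) g = 0.
Proof.
have D (a b c a' b' c' : dsum L) : a + b + c = 0 -> a' + b' + c' = 0 ->
    (a + a') + (b + b') + (c + c') = 0.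
  by move=> h1 h2; rewrite [X in X + _]addrACA [LHS]addrACA h1 h2 addr0.
elim/(@dsum_ind _ L): f => [|f f' IH IH'|i x].
- by rewrite !(lie_br0l, lie_br0r) !addr0.
- by rewrite !(lie_brDl, lie_brDr); exact: D.
elim/(@dsum_ind _ L): g => [|g g' IH IH'|j y].
- by rewrite !(lie_br0l, lie_br0r) !addr0.
- by rewrite !(lie_brDl, lie_brDr); exact: D.
elim/(@dsum_ind _ L): h => [|h h' IH IH'|k z].
- by rewrite !(lie_br0l, lie_br0r) !addr0.
- by rewrite !(lie_brDl, lie_brDr); exact: D.
by rewrite !lie_br_in glie_jacobi.
Qed.

Definition lie_comp (l : pos Lam) : set (dsum L) := range (@dsum_in _ L l).

Record Der (l : pos Lam) := MkDer {
  der_fun :> dsum L -> dsum L;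
  derD : forall x y, der_fun (x + y) = der_fun x + der_fun y;
  der_br : forall x y,
    der_fun (lie_br x y) = lie_br (der_fun x) y + lie_br x (der_fun y);
  der_deg : forall m, der_fun @` lie_comp m `<=` lie_comp (posD l m)
}.

HB.instance Definition _ l := gen_eqMixin (Der l).
HB.instance Definition _ l := gen_choiceMixin (Der l).

Lemma derP l (f g : Der l) : (forall x, f x = g x) -> f = g.
Proof.
case: f g => [f f1 f2 f3] [g g1 g2 g3] /= fg.
have {}fg : f = g by apply: functional_extensionality_dep.
by subst g; congr MkDer; exact: Prop_irrelevance.
Qed.

Section DerZmod.
Context (l : pos Lam).
Implicit Types f g : Der l.

Lemma lie_comp0 m : lie_comp m 0.
Proof. by exists 0 => //; rewrite raddf0. Qed.
Lemma lie_compN m x : lie_comp m x -> lie_comp m (- x).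
Proof. by case=> a _ <-; exists (- a) => //; rewrite raddfN. Qed.
Lemma lie_compD m x y : lie_comp m x -> lie_comp m y -> lie_comp m (x + y).
Proof. by case=> a _ <- [b _ <-]; exists (a + b) => //; rewrite raddfD. Qed.
Lemma lie_brNl x y : lie_br (- x) y = - lie_br x y.
Proof. by apply: (addIr (lie_br x y)); rewrite -lie_brDl !addNr lie_br0l. Qed.
Lemma lie_brNr x y : lie_br x (- y) = - lie_br x y.
Proof. by rewrite lie_brC lie_brNl -lie_brC. Qed.

Definition der0 : Der l.
Proof.
apply: (@MkDer l (fun=> 0)) => [x y|x y|m _ [x _ <-]].
- by rewrite addr0.
- by rewrite lie_br0l lie_br0r addr0.
- exact: lie_comp0.
Defined.

Definition derN f : Der l.
Proof.
apply: (@MkDer l (fun x => - f x)) => [x y|x y|m _ [x mx <-]].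
- by rewrite derD opprD.
- by rewrite der_br opprD lie_brNl lie_brNr.
- by apply: lie_compN; apply: (@der_deg l f m); exists x.
Defined.

Definition derA f g : Der l.
Proof.
apply: (@MkDer l (fun x => f x + g x)) => [x y|x y|m _ [x mx <-]].
- by rewrite !derD addrACA.
- by rewrite !der_br lie_brDl lie_brDr addrACA.
- by apply: lie_compD; [apply: (@der_deg l f m)|apply: (@der_deg l g m)]; exists x.
Defined.

Lemma derAA : associative derA.
Proof. by move=> f g h; apply: derP => x /=; rewrite addrA. Qed.
Lemma derAC : commutative derA.
Proof. by move=> f g; apply: derP => x /=; rewrite addrC. Qed.
Lemma der0A : left_id der0 derA.
Proof. by move=> f; apply: derP => x /=; rewrite add0r. Qed.
Lemma derNA : left_inverse der0 derN derA.
Proof. by move=> f; apply: derP => x /=; rewrite addNr. Qed.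

HB.instance Definition _ :=
  GRing.isZmodule.Build (Der l) derAA derAC der0A derNA.

End DerZmod.
End GradedLie.
Arguments gradedLie Lam : clear implicits.
Arguments Der {Lam} L l.

Section Groups.
Context {K : groupType}.

(* not MathComp's [~ a, b], which is a^-1 * b^-1 * a * b *)
Definition gcomm (a b : K) : K := (a * b * a^-1 * b^-1)%g.

Lemma gcommV a b : (gcomm a b)^-1%g = gcomm b a.
Proof. by rewrite /gcomm !invgM !invgK !mulgA. Qed.

Lemma gcommMl a a' b :
  gcomm (a * a') b = (a * gcomm a' b * a^-1 * gcomm a b)%g.
Proof. by rewrite /gcomm !invgM !mulgA !mulgVK. Qed.

Lemma gcommMr a b b' :
  gcomm a (b * b') = (gcomm a b * (b * gcomm a b' * b^-1))%g.
Proof. by rewrite /gcomm !invgM !mulgA !mulgVK. Qed.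

Lemma hall_witt a b c :
  (gcomm (gcomm a b) (b * c * b^-1) * gcomm (gcomm b c) (c * a * c^-1)
    * gcomm (gcomm c a) (a * b * a^-1))%g = 1%g.
Proof. by rewrite /gcomm !(invgM, invgK, mulgA, mulgVK, mulgK, mulgV). Qed.

Definition subgroup (A : set K) : Prop :=
  [/\ A 1%g, (forall a b, A a -> A b -> A (a * b)%g)
    & (forall a, A a -> A a^-1%g)].

Definition normal_subgroup (A : set K) : Prop :=
  subgroup A /\ (forall k a, A a -> A (k * a * k^-1)%g).

Definition generated (A : set K) : set K := smallest subgroup A.

Lemma generated_subgroup (A : set K) : subgroup (generated A).
Proof.
split=> [|a b Aa Ab|a Aa] B [sB AB]; first by case: sB.
  by have [_ + _] := sB; apply; [apply: Aa|apply: Ab].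
by have [_ _ +] := sB; apply; apply: Aa.
Qed.

End Groups.

Record filtration (Lam : orderedMonoidType) (K : groupType) := Filtration {
  fil :> Lam -> set K;
  fil_normal : forall l, normal_subgroup (fil l);
  fil0 : fil 0 = setT;
  fil_le : forall l m, ole l m -> fil m `<=` fil l;
  fil_comm : forall l m,
    generated [set gcomm a b | a in fil l & b in fil m] `<=` fil (l + m)
}.

Section Filtration.
Context {Lam : orderedMonoidType} {K : groupType} (F : filtration Lam K).

Definition fil_gt (l : Lam) : set K :=
  generated (\bigcup_(m in [set m | olt l m]) F m).

Lemma fil1 l : F l 1%g. Proof. by have [[]] := fil_normal F l. Qed.
Lemma filM l a b : F l a -> F l b -> F l (a * b)%g.
Proof. by have [[_ + _ _]] := fil_normal F l; apply. Qed.
Lemma filV l a : F l a -> F l a^-1%g.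
Proof. by have [[_ _ + _]] := fil_normal F l; apply. Qed.
Lemma filJ l k a : F l a -> F l (k * a * k^-1)%g.
Proof. by have [_] := fil_normal F l; apply. Qed.
Lemma fil_gcomm l m a b : F l a -> F m b -> F (l + m) (gcomm a b).
Proof.
by move=> la mb; apply: fil_comm; apply: sub_gen_smallest; exists a => //; exists b.
Qed.

Lemma fil_gt1 l : fil_gt l 1%g.
Proof. by have [] := generated_subgroup (\bigcup_(m in [set m | olt l m]) F m). Qed.
Lemma fil_gtM l a b : fil_gt l a -> fil_gt l b -> fil_gt l (a * b)%g.
Proof.
by have [_ + _] := generated_subgroup (\bigcup_(m in [set m | olt l m]) F m); apply.
Qed.
Lemma fil_gtV l a : fil_gt l a -> fil_gt l a^-1%g.
Proof.
by have [_ _ +] := generated_subgroup (\bigcup_(m in [set m | olt l m]) F m); apply.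
Qed.

Lemma fil_gt_sub l m a : olt l m -> F m a -> fil_gt l a.
Proof. by move=> lm ma; apply: sub_gen_smallest; exists m. Qed.

Lemma fil_gt_ind l (P : set K) : P 1%g ->
  (forall a b, fil_gt l a -> fil_gt l b -> P a -> P b -> P (a * b)%g) ->
  (forall a, fil_gt l a -> P a -> P a^-1%g) ->
  (forall m a, olt l m -> F m a -> P a) -> fil_gt l `<=` P.
Proof.
move=> P1 PM PV Pm a la; suff: (fil_gt l `&` P) a by case.
apply: (la (fil_gt l `&` P)); split.
  split=> [|x y [lx Px] [ly Py]|x [lx Px]]; first by split=> //; exact: fil_gt1.
    by split; [exact: fil_gtM|exact: PM].
  by split; [exact: fil_gtV|exact: PV].
move=> x [m lm mx]; split; [exact: fil_gt_sub mx|exact: Pm mx].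
Qed.

Lemma fil_gtJ l k a : fil_gt l a -> fil_gt l (k * a * k^-1)%g.
Proof.
move: a; apply: fil_gt_ind => [|a b _ _ la lb|a _ la|m a lm ma].
- by rewrite mulg1 mulgV; exact: fil_gt1.
- rewrite (_ : (_ * _ * _ = (k * a * k^-1) * (k * b * k^-1))%g).
    exact: fil_gtM.
  by rewrite !mulgA mulgVK.
- rewrite (_ : (_ * _ * _ = (k * a * k^-1)^-1)%g); first exact: fil_gtV.
  by rewrite !invgM invgK mulgA.
- by apply: (fil_gt_sub lm); exact: filJ.
Qed.

Lemma fil_gtW l : fil_gt l `<=` F l.
Proof.
apply: fil_gt_ind => [|a b _ _|a _|m a /andP[_ lm]].
- exact: fil1.
- exact: filM.
- exact: filV.
- exact: fil_le.
Qed.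

Lemma fil_gt_le l m : olt l m -> fil_gt m `<=` fil_gt l.
Proof. by move=> lm a /fil_gtW; exact: fil_gt_sub. Qed.

Definition level (l : Lam) := {a : K | a \in F l}.

HB.instance Definition _ l := SubChoice.on (level l).

Lemma level_closed l : group_closed (fun a => a \in F l).
Proof.
split=> [|a b]; rewrite !inE; first exact: fil1.
by move=> la lb; apply: filM => //; exact: filV.
Qed.

HB.instance Definition _ l :=
  SubChoice_isSubGroup.Build K (fun a => a \in F l) (level l) (level_closed l).

Lemma level_in l (a : level l) : F l (val a).
Proof. by have := valP a; rewrite inE. Qed.

Definition mk_level l a (la : F l a) : level l := Sub a (mem_set la).

Definition level_comm l m (a : level l) (b : level m) : level (l + m) :=
  mk_level (fil_gcomm (level_in a) (level_in b)).

(* a and b have the same left coset modulo [fil_gt l]: a^-1 * b \in fil_gt l *)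
Definition level_eqv l : rel (level l) :=
  fun a b => ((val a)^-1 * val b)%g \in fil_gt l.

Lemma level_eqv_refl l : reflexive (@level_eqv l).
Proof. by move=> a; rewrite /level_eqv inE mulVg; exact: fil_gt1. Qed.

Lemma level_eqv_sym l : symmetric (@level_eqv l).
Proof.
suff H a b : @level_eqv l a b -> level_eqv b a by move=> a b; apply/idP/idP; exact: H.
by rewrite /level_eqv !inE => /fil_gtV; rewrite invgM invgK.
Qed.

Lemma level_eqv_trans l : transitive (@level_eqv l).
Proof.
move=> b a c; rewrite /level_eqv !inE => ab bc.
by have := fil_gtM ab bc; rewrite mulgA mulgK.
Qed.

Canonical level_equiv l := EquivRel (@level_eqv l)
  (@level_eqv_refl l) (@level_eqv_sym l) (@level_eqv_trans l).

End Filtration.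

Section Graded.
Context {Lam : goodMonoidType} {K : groupType} (F : filtration Lam K).
Local Open Scope quotient_scope.

Definition gr (l : pos Lam) := {eq_quot (@level_equiv _ _ F (val l))}.

HB.instance Definition _ l := Choice.on (gr l).

Definition cls (l : pos Lam) (a : level F (val l)) : gr l := \pi_(gr l) a.

Lemma clsP l (a b : level F (val l)) :
  cls a = cls b <-> fil_gt F (val l) ((val a)^-1 * val b)%g.
Proof.
split=> [/eqP|h]; last apply/eqP; rewrite /cls.
  by rewrite (eqmodE (@level_equiv _ _ F (val l)))/= /level_eqv inE.
by rewrite (eqmodE (@level_equiv _ _ F (val l)))/= /level_eqv inE.
Qed.

Lemma reprgK l (x : gr l) : cls (repr x) = x.
Proof. exact: reprK. Qed.

Lemma cls_ind l (P : gr l -> Prop) : (forall a, P (cls a)) -> forall x, P x.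
Proof. by move=> Pc x; rewrite -(reprgK x). Qed.

Lemma oltDl (l m : pos Lam) : olt (val l) (val m + val l).
Proof. by rewrite -[X in olt X _]add0r; apply: oltD2r; exact: pos_gt0. Qed.

Lemma oltDr (l m : pos Lam) : olt (val l) (val l + val m).
Proof. by rewrite addrC oltDl. Qed.

Lemma cls_mulC l (a b : level F (val l)) : cls (a * b)%g = cls (b * a)%g.
Proof.
apply/clsP; rewrite !valM.
have : F (val l + val l) (gcomm (val b)^-1 (val a)^-1)%g.
  by apply: fil_gcomm; apply: filV; exact: level_in.
rewrite /gcomm !invgK => h; apply: (fil_gt_sub (oltDl l l)).
by rewrite invgM !mulgA.
Qed.

Lemma cls_mulE l (a a' b b' : level F (val l)) :
  cls a = cls a' -> cls b = cls b' -> cls (a * b)%g = cls (a' * b')%g.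
Proof.
move=> /clsP aa /clsP bb; apply/clsP; rewrite !valM invgM.
rewrite (_ : (_ * _)%g = ((val b)^-1 * ((val a)^-1 * val a') * (val b)^-1^-1)
    * ((val b)^-1 * val b'))%g; first by apply: fil_gtM => //; exact: fil_gtJ.
by rewrite invgK !mulgA mulgK.
Qed.

Lemma cls_invE l (a a' : level F (val l)) :
  cls a = cls a' -> cls a^-1%g = cls a'^-1%g.
Proof.
move=> aa.
have: cls (a'^-1 * a' * a^-1)%g = cls (a'^-1 * a * a^-1)%g.
  by do 2?apply: cls_mulE.
by rewrite mulVg mul1g mulgK.
Qed.

(* By [clsM] and [clsV], the choice of representatives does not matter.      *)
Definition gr_add l (x y : gr l) : gr l := cls (repr x * repr y)%g.
Definition gr_opp l (x : gr l) : gr l := cls (repr x)^-1%g.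
Definition gr_zero l : gr l := cls 1%g.

Lemma gr_addE l (a b : level F (val l)) :
  gr_add (cls a) (cls b) = cls (a * b)%g.
Proof. by apply: cls_mulE; rewrite reprgK. Qed.

Lemma gr_oppE l (a : level F (val l)) : gr_opp (cls a) = cls a^-1%g.
Proof. by apply: cls_invE; rewrite reprgK. Qed.

Lemma gr_addA l : associative (@gr_add l).
Proof.
elim/cls_ind=> a; elim/cls_ind=> b; elim/cls_ind=> c.
by rewrite !gr_addE mulgA.
Qed.
Lemma gr_addC l : commutative (@gr_add l).
Proof. by elim/cls_ind=> a; elim/cls_ind=> b; rewrite !gr_addE cls_mulC. Qed.
Lemma gr_add0 l : left_id (gr_zero l) (@gr_add l).
Proof. by elim/cls_ind=> a; rewrite gr_addE mul1g. Qed.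
Lemma gr_addN l : left_inverse (gr_zero l) (@gr_opp l) (@gr_add l).
Proof. by elim/cls_ind=> a; rewrite gr_oppE gr_addE mulVg. Qed.

HB.instance Definition _ l := GRing.isZmodule.Build (gr l)
  (@gr_addA l) (@gr_addC l) (@gr_add0 l) (@gr_addN l).

Lemma clsM l (a b : level F (val l)) : cls (a * b)%g = cls a + cls b.
Proof. by rewrite [RHS]gr_addE. Qed.

Lemma clsV l (a : level F (val l)) : cls a^-1%g = - cls a.
Proof. by rewrite [RHS]gr_oppE. Qed.

Lemma cls1 l : cls (1%g : level F (val l)) = 0.
Proof. by []. Qed.

Lemma cls_eq0 l (a : level F (val l)) : fil_gt F (val l) (val a) -> cls a = 0.
Proof.
by move=> h; apply/esym; rewrite -cls1; apply/clsP; rewrite val1 invg1 mul1g.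
Qed.

(* By [gr_brE], the choice of representatives does not matter.               *)
Definition gr_br l m (x : gr l) (y : gr m) : gr (posD l m) :=
  cls (level_comm (repr x) (repr y) : level F (val (posD l m))).

Lemma gcomm_gtr (l : Lam) m a b :
  F l a -> fil_gt F m b -> fil_gt F (l + m) (gcomm a b).
Proof.
move=> la; move: b; apply: fil_gt_ind => [|b b' _ _ ab ab'|b _ ab|n b mn nb].
- by rewrite /gcomm invg1 !mulg1 mulgV; exact: fil_gt1.
- by rewrite gcommMr; apply: fil_gtM => //; exact: fil_gtJ.
- rewrite (_ : gcomm a b^-1 = (b^-1 * (gcomm a b)^-1 * b^-1^-1))%g.
    by apply: fil_gtJ; exact: fil_gtV.
  by rewrite /gcomm !(invgM, invgK, mulgA, mulVg, mul1g).
- apply: fil_gt_sub (fil_gcomm la nb).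
  by rewrite ![l + _]addrC; exact: oltD2r.
Qed.

Lemma gcomm_gtl (l : Lam) m a b :
  fil_gt F l a -> F m b -> fil_gt F (l + m) (gcomm a b).
Proof.
by move=> la mb; rewrite -gcommV addrC; apply: fil_gtV; exact: gcomm_gtr.
Qed.

Lemma cls_conj l (m : pos Lam) k (a b : level F (val l)) : F (val m) k ->
  val a = (k * val b * k^-1)%g -> cls a = cls b.
Proof.
move=> mk ab; apply/esym/clsP; rewrite ab.
have h : F (val m + val l) (gcomm (val b)^-1 k)%g.
  by rewrite addrC; apply: fil_gcomm => //; apply: filV; exact: level_in.
apply: (fil_gt_sub (oltDl l m)).
by move: h; rewrite /gcomm invgK !mulgA.
Qed.

(* Retyping: [val (posD l m)] is convertible to [val l + val m].              *)
Definition level_br (l m : pos Lam) (a : level F (val l)) (b : level F (val m)) :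
  level F (val (posD l m)) := level_comm a b.

Lemma cls_brl l m (a a' : level F (val l)) (b : level F (val m)) :
  cls a = cls a' -> cls (level_br a b) = cls (level_br a' b).
Proof.
move=> /clsP; set n := (_ * _)%g => ln; apply/clsP => /=.
have -> : val a' = (val a * n)%g by rewrite mulVKg.
rewrite gcommMl mulgA -{2}[gcomm (val a) (val b)]invgK.
by apply: fil_gtJ; apply: fil_gtJ; apply: gcomm_gtl => //; exact: level_in.
Qed.

Lemma cls_brr l m (a : level F (val l)) (b b' : level F (val m)) :
  cls b = cls b' -> cls (level_br a b) = cls (level_br a b').
Proof.
move=> /clsP; set n := (_ * _)%g => mn; apply/clsP => /=.
have -> : val b' = (val b * n)%g by rewrite mulVKg.
rewrite gcommMr mulKg.
by apply: fil_gtJ; apply: gcomm_gtr => //; exact: level_in.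
Qed.

Lemma gr_brE l m (a : level F (val l)) (b : level F (val m)) :
  gr_br (cls a) (cls b) = cls (level_br a b).
Proof.
by transitivity (cls (level_br (repr (cls a)) b));
  [apply: cls_brr|apply: cls_brl]; rewrite reprgK.
Qed.

Lemma gr_brDl l m (x x' : gr l) (y : gr m) :
  gr_br (x + x') y = gr_br x y + gr_br x' y.
Proof.
elim/cls_ind: x => a; elim/cls_ind: x' => a'; elim/cls_ind: y => b.
rewrite -clsM !gr_brE addrC.
have h : F (val l + val m) (val a * gcomm (val a') (val b) * (val a)^-1)%g.
  by apply: filJ; apply: fil_gcomm; exact: level_in.
have <- : cls (mk_level h : level F (val (posD l m))) = cls (level_br a' b).
  by apply: (cls_conj (m := l) (k := val a)) => //; exact: level_in.
by rewrite -clsM; congr cls; apply: val_inj; rewrite /= gcommMl.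
Qed.

Lemma gr_brDr l m (x : gr l) (y y' : gr m) :
  gr_br x (y + y') = gr_br x y + gr_br x y'.
Proof.
elim/cls_ind: x => a; elim/cls_ind: y => b; elim/cls_ind: y' => b'.
rewrite -clsM !gr_brE.
have h : F (val l + val m) (val b * gcomm (val a) (val b') * (val b)^-1)%g.
  by apply: filJ; apply: fil_gcomm; exact: level_in.
have <- : cls (mk_level h : level F (val (posD l m))) = cls (level_br a b').
  by apply: (cls_conj (m := m) (k := val b)) => //; exact: level_in.
by rewrite -clsM; congr cls; apply: val_inj; rewrite /= gcommMr.
Qed.

Lemma gr_brxx l (x : gr l) : gr_br x x = 0.
Proof.
elim/cls_ind: x => a; rewrite gr_brE; apply: cls_eq0.
by rewrite /= /gcomm mulgK mulgV; exact: fil_gt1.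
Qed.

Lemma dsum_in_cls l m (a : level F (val l)) (b : level F (val m)) :
  l = m -> val a = val b -> dsum_in (cls a) = dsum_in (cls b).
Proof. by move=> lm; subst m => ab; congr (dsum_in (cls _)); exact: val_inj. Qed.

Lemma gr_brC l m (x : gr l) (y : gr m) :
  dsum_in (gr_br x y) = - dsum_in (gr_br y x).
Proof.
elim/cls_ind: x => a; elim/cls_ind: y => b.
rewrite !gr_brE -raddfN -clsV; apply: dsum_in_cls; first exact: posDC.
by rewrite /= gcommV.
Qed.

Lemma gr_jacobi l m n (x : gr l) (y : gr m) (z : gr n) :
  dsum_in (gr_br (gr_br x y) z) + dsum_in (gr_br (gr_br y z) x)
    + dsum_in (gr_br (gr_br z x) y) = 0.
Proof.
elim/cls_ind: x => a; elim/cls_ind: y => b; elim/cls_ind: z => c.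
have H (p q r : pos Lam) (u : level F (val p)) (v : level F (val q))
    (w : level F (val r)) : posD (posD p q) r = posD (posD l m) n ->
    exists t : level F (val (posD (posD l m) n)),
      val t = gcomm (gcomm (val u) (val v)) (val v * val w * (val v)^-1)%g /\
      dsum_in (gr_br (gr_br (cls u) (cls v)) (cls w)) = dsum_in (cls t).
  move=> <-.
  have h : F (val r) (val v * val w * (val v)^-1)%g.
    by apply: filJ; exact: level_in.
  exists (level_br (level_br u v) (mk_level h)); split => //.
  rewrite -(@cls_conj r q (val v) (mk_level h) w) ?gr_brE//.
  exact: level_in.
have [t [tE ->]] := H _ _ _ a b c erefl.
have [|t' [tE' ->]] := H _ _ _ b c a; first by rewrite [LHS]posDC posDA.
have [|t'' [tE'' ->]] := H _ _ _ c a b; first by rewrite -posDA posDC.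
rewrite -!raddfD (_ : _ + _ = 0) ?raddf0//.
transitivity (cls (t * t' * t'')%g); first by rewrite !clsM.
rewrite -cls1; congr cls; apply: val_inj; rewrite !valM tE tE' tE''; exact: hall_witt.
Qed.

Definition gr_lie : gradedLie Lam :=
  GradedLie gr_brDl gr_brDr gr_brxx gr_brC gr_jacobi.

End Graded.

Record gaction (G K : groupType) := GAction {
  gact :> G -> K -> K;
  gact1 : forall k, gact 1%g k = k;
  gactM : forall g h k, gact (g * h)%g k = gact g (gact h k);
  gact_mul : forall g k k', gact g (k * k')%g = (gact g k * gact g k')%g
}.

(* the commutator [g, k] of the semidirect product, as an element of K *)
Definition act_comm (G K : groupType) (act : gaction G K) (g : G) (k : K) : K :=
  (act g k * k^-1)%g.

Definition filtered_action (Lam : orderedMonoidType) (G K : groupType)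
    (FG : filtration Lam G) (FK : filtration Lam K) (act : gaction G K) : Prop :=
  forall l m, generated [set act_comm act g k | g in FG l & k in FK m]
    `<=` FK (l + m).

Section LevelAction.
Context {Lam : goodMonoidType} {G K : groupType}.
Context {FG : filtration Lam G} {FK : filtration Lam K} {act : gaction G K}.

Lemma act_comm_in (l m : Lam) (g : level FG l) (a : level FK m) :
  filtered_action FG FK act -> FK (l + m) (act_comm act (val g) (val a)).
Proof.
move=> actF; apply: actF; apply: sub_gen_smallest.
by exists (val g); [exact: level_in|exists (val a) => //; exact: level_in].
Qed.

Definition level_act_comm (actF : filtered_action FG FK act) (l m : pos Lam)
    (g : level FG (val l)) (a : level FK (val m)) : level FK (val (posD l m)) :=
  mk_level (act_comm_in g a actF).

End LevelAction.

(* Main.v *)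
Require Import Defs.
From mathcomp Require Import all_boot all_algebra.
From mathcomp Require Import all_classical.

Import GRing.Theory.
Local Open Scope ring_scope.
Local Open Scope classical_set_scope.

(** In the semidirect product of [K] and [G], the assignment [a |-> [g, a]]
    satisfies [[g, ab] = [g, a] * a[g, b]a^-1] and
    [[gh, a] = [g, [h, a]] * [h, a] * [g, a]].  Modulo deeper terms of the
    filtration, conjugation by elements of positive degree and the triple
    commutator disappear, so that [[g, -]] induces a map that is additive in
    [a] and in [g].  For the Leibniz rule one puts [x = [g, a]] and
    [y = [g, b]], so that [g] sends the commutator [[a, b]] to [[xa, yb]], which
    is expanded; [[x, y]] and the commutators of [x] and [y] with [[a, b]] are
    too deep to contribute. *)

(** * Additive maps of direct sums given on components *)

Section DirectSumMap.
Context {I J : choiceType} (M : I -> zmodType) (N : J -> zmodType).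
Context (s : I -> J) (phi : forall i, M i -> N (s i)).
Hypothesis phiD : forall i (x y : M i), phi i (x + y) = phi i x + phi i y.

Definition dsum_map (f : dsum M) : dsum N :=
  \sum_(i \in [set i | f i != 0]) dsum_in (phi i (f i)).

(** Indices outside the support contribute nothing, since additivity forces [phi i 0 = 0]. The
    freedom in [r] lets [f], [g] and [f + g] be summed over one common list in [dsum_mapD]. *)
Lemma dsum_mapE (f : dsum M) (r : seq I) : uniq r ->
  (forall i, f i != 0 -> i \in r) ->
  dsum_map f = \sum_(i <- r) dsum_in (phi i (f i)).
Proof.
move=> ur fr; transitivity (\sum_(i <- r | f i != 0) dsum_in (phi i (f i))).
  by rewrite /dsum_map (bigfs _ ur)// => i fi; rewrite fr.
rewrite big_mkcond/=; apply: eq_bigr => i _.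
have [->|//] := eqVneq (f i) 0.
have -> : phi i 0 = 0 by apply: (addIr (phi i 0)); rewrite -phiD !add0r.
by rewrite raddf0.
Qed.

Lemma dsum_map_in i (x : M i) : dsum_map (dsum_in x) = dsum_in (phi i x).
Proof.
rewrite (@dsum_mapE _ [:: i]) ?big_seq1 ?dsum_inE// => j.
by rewrite inE; apply: contra_neqT => ji; rewrite dsum_in_out// eq_sym.
Qed.

Lemma dsum_mapD f g : dsum_map (f + g) = dsum_map f + dsum_map g.
Proof.
have ffin := dsum_finite f; have gfin := dsum_finite g.
have fin : finite_set ([set i | f i != 0] `|` [set i | g i != 0]).
  by rewrite finite_setU.
set r := finmap.enum_fset (fset_set ([set i | f i != 0] `|` [set i | g i != 0])).
have fr i : f i != 0 -> i \in r by rewrite /= in_fset_set// inE; left.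
have gr i : g i != 0 -> i \in r by rewrite /= in_fset_set// inE; right.
have fgr i : (f + g) i != 0 -> i \in r.
  apply: contraNT => ri; have -> : (f + g) i = f i + g i by [].
  have /eqP -> : f i == 0 by apply: contraNT ri; exact: fr.
  have /eqP -> : g i == 0 by apply: contraNT ri; exact: gr.
  by rewrite addr0.
rewrite !(@dsum_mapE _ r) ?finmap.fset_uniq// -big_split/=.
by apply: eq_bigr => i _; rewrite phiD raddfD.
Qed.

Lemma dsum_map0 : dsum_map 0 = 0.
Proof. by apply: (addIr (dsum_map 0)); rewrite -dsum_mapD !add0r. Qed.

End DirectSumMap.
Arguments dsum_map {I J M N s}.

(** * Graded derivations assembled from homogeneous components *)

Section DerivationOfComponents.
Context {Lam : goodMonoidType} (L : gradedLie Lam) (l : pos Lam).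
Context (phi : forall m, L m -> L (posD l m)).
Hypothesis phiD : forall m (x y : L m), phi m (x + y) = phi m x + phi m y.
(** The Leibniz rule is imposed in the direct sum because its three terms have degrees that are
    equal but not convertible. *)
Hypothesis phi_br : forall m n (x : L m) (y : L n),
  dsum_in (phi _ (glie_br x y)) =
    dsum_in (glie_br (phi m x) y) + dsum_in (glie_br x (phi n y)).

(** Both sides are additive in [x] and in [y], so homogeneous elements suffice. *)
Lemma dsum_map_lie_br (x y : dsum L) :
  dsum_map phi (lie_br x y) =
    lie_br (dsum_map phi x) y + lie_br x (dsum_map phi y).
Proof.
elim/(@dsum_ind _ L): x => [|f f' IH IH'|i x].
- by rewrite dsum_map0// !lie_br0l dsum_map0// addr0.
- by rewrite dsum_mapD// !lie_brDl dsum_mapD// IH IH' addrACA.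
elim/(@dsum_ind _ L): y => [|g g' IH IH'|j y].
- by rewrite dsum_map0// !lie_br0r dsum_map0// addr0.
- by rewrite dsum_mapD// !lie_brDr dsum_mapD// IH IH' addrACA.
by rewrite lie_br_in !dsum_map_in// !lie_br_in phi_br.
Qed.

Lemma dsum_map_deg m :
  dsum_map phi @` @lie_comp _ L m `<=` lie_comp (posD l m).
Proof.
by move=> _ [_ [x _ <-] <-]; rewrite dsum_map_in//; exists (phi m x).
Qed.

Definition der_of_components : Der L l :=
  MkDer (dsum_mapD _ _ _ _ phiD) dsum_map_lie_br dsum_map_deg.

End DerivationOfComponents.

(** * Commutator identities for a group acting on a group *)

Section Action.
Context {G K : groupType} (act : gaction G K).
Local Open Scope group_scope.

Lemma gact_1 g : act g 1 = 1.
Proof. by apply: (mulgI (act g 1)); rewrite -gact_mul !mulg1. Qed.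

Lemma gactV g k : act g k^-1 = (act g k)^-1.
Proof. by apply: (mulgI (act g k)); rewrite -gact_mul !mulgV gact_1. Qed.

Lemma act_commE g a : act g a = act_comm act g a * a.
Proof. by rewrite /act_comm mulgVK. Qed.

Lemma act_comm1 g : act_comm act g 1 = 1.
Proof. by rewrite /act_comm gact_1 mulgV. Qed.

Lemma act_commMr g a b :
  act_comm act g (a * b) = act_comm act g a * (a * act_comm act g b * a^-1).
Proof. by rewrite /act_comm gact_mul invgM !mulgA mulgVK. Qed.

Lemma act_commVr g a :
  act_comm act g a^-1 = a^-1 * (act_comm act g a)^-1 * a^-1^-1.
Proof. by rewrite /act_comm gactV invgM !invgK mulKg. Qed.

Lemma act_commMl g h a : act_comm act (g * h) a =
  act_comm act g (act_comm act h a) * (act_comm act h a * act_comm act g a).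
Proof.
by rewrite mulgA -act_commE {3}/act_comm mulgA -gact_mul -act_commE -gactM.
Qed.

(** The factors are grouped by their role: the outer two are conjugates of the Leibniz terms
    [gcomm a y] and [gcomm x b], and the middle one collects the terms of higher degree. *)
Lemma act_comm_gcomm g a b (x := act_comm act g a) (y := act_comm act g b)
    (c := gcomm a b) :
  act_comm act g c = (x * gcomm a y * x^-1)
    * ((x * gcomm y c * x^-1 * gcomm x c) * (c * gcomm x y * c^-1))
    * (c * y * gcomm x b * (c * y)^-1).
Proof.
have -> : act_comm act g c = gcomm (x * a) (y * b) * c^-1.
  by rewrite -!act_commE /act_comm /gcomm !gact_mul !gactV.
rewrite {}/c; move: x y => x y; rewrite /gcomm.
by rewrite !(invgM, invgK, mulgA, mulgVK, mulgK).
Qed.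

End Action.

(** * The derivations induced on the graded Lie algebra *)

Section Tau.
Context {Lam : goodMonoidType} {G K : groupType}.
Context {FG : filtration Lam G} {FK : filtration Lam K} {act : gaction G K}.
Hypothesis actF : filtered_action FG FK act.

Lemma fil_act_comm {l m : Lam} {g a} :
  FG l g -> FK m a -> FK (l + m) (act_comm act g a).
Proof.
by move=> lg ma; apply: actF; apply: sub_gen_smallest; exists g => //; exists a.
Qed.

(** Induction over the generated subgroup; on a generator of degree [n] above [m], goodness of the
    monoid keeps [l + n] strictly above [l + m]. *)
Lemma act_comm_gt (l m : Lam) g a : FG l g -> fil_gt FK m a ->
  fil_gt FK (l + m) (act_comm act g a).
Proof.
move=> lg; move: a; apply: fil_gt_ind => [|a b _ _ ha hb|a _ ha|n a mn na].
- by rewrite act_comm1; exact: fil_gt1.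
- by rewrite act_commMr; apply: fil_gtM => //; exact: fil_gtJ.
- by rewrite act_commVr; apply: fil_gtJ; exact: fil_gtV.
- apply: fil_gt_sub (fil_act_comm lg na).
  by rewrite ![l + _]addrC; exact: oltD2r.
Qed.

Context {l : pos Lam}.
Implicit Types (g h : level FG (val l)) (m n : pos Lam).

Lemma cls_act_commMr g m (a b : level FK (val m)) :
  cls (level_act_comm actF g (a * b)%g) =
    cls (level_act_comm actF g a) + cls (level_act_comm actF g b).
Proof.
have ab : FK (val l + val m) (val a * act_comm act (val g) (val b) * (val a)^-1)%g.
  by apply: filJ; apply: fil_act_comm; exact: level_in.
have <- : cls (mk_level ab : level FK (val (posD l m))) =
    cls (level_act_comm actF g b).
  by apply: (cls_conj (m := m) (k := val a)) => //; exact: level_in.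
by rewrite -clsM; congr cls; apply: val_inj; rewrite /= act_commMr.
Qed.

Lemma cls_act_commr g m (a b : level FK (val m)) : cls a = cls b ->
  cls (level_act_comm actF g a) = cls (level_act_comm actF g b).
Proof.
move=> /clsP ab; apply/clsP => /=.
(* Writing [b] as [a] times an element of [fil_gt FK (val m)] turns the quotient of the two
   commutators into a conjugate covered by [act_comm_gt]. *)
have -> : val b = (val a * ((val a)^-1 * val b))%g by rewrite mulVKg.
rewrite act_commMr mulKg; apply: fil_gtJ; apply: act_comm_gt => //.
exact: level_in.
Qed.

Lemma cls_act_commMl g h m (a : level FK (val m)) :
  cls (level_act_comm actF (g * h)%g a) =
    cls (level_act_comm actF g a) + cls (level_act_comm actF h a).
Proof.
have gha : FK (val l + (val l + val m))
    (act_comm act (val g) (act_comm act (val h) (val a))).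
  by do 2![apply: fil_act_comm; first exact: level_in]; exact: level_in.
have lt_lm : olt (val l + val m) (val l + (val l + val m)).
  exact: (oltDl (posD l m) l).
(* The summands are swapped to match the factor order in [act_commMl]; the added zero becomes the
   class of the triple commutator [t]. *)
rewrite addrC -clsM -[RHS]add0r.
pose t : level FK (val (posD l m)) := mk_level (fil_le (proj2 (andP lt_lm)) gha).
rewrite -(cls_eq0 (a := t)); last exact: fil_gt_sub lt_lm gha.
by rewrite -clsM; congr cls; apply: val_inj; rewrite /= act_commMl.
Qed.

Definition tau_comp g m (x : gr FK m) : gr FK (posD l m) :=
  cls (level_act_comm actF g (repr x)).

Lemma tau_compE g m (a : level FK (val m)) :
  tau_comp g m (cls a) = cls (level_act_comm actF g a).
Proof. by apply: cls_act_commr; rewrite reprgK. Qed.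

Lemma tau_compD g m (x y : gr FK m) :
  tau_comp g m (x + y) = tau_comp g m x + tau_comp g m y.
Proof.
move: x; apply: cls_ind => a; move: y; apply: cls_ind => b.
by rewrite -clsM !tau_compE cls_act_commMr.
Qed.

Lemma tau_comp_br g m n (u : gr FK m) (v : gr FK n) :
  dsum_in (tau_comp g _ (gr_br u v)) =
    dsum_in (gr_br (tau_comp g m u) v) + dsum_in (gr_br u (tau_comp g n v)).
Proof.
move: u; apply: cls_ind => a; move: v; apply: cls_ind => b.
rewrite !(gr_brE, tau_compE).
set N := posD l (posD m n).
pose x := act_comm act (val g) (val a); pose y := act_comm act (val g) (val b).
pose c := gcomm (val a) (val b).
have Kx : FK (val (posD l m)) x by apply: fil_act_comm; exact: level_in.
have Ky : FK (val (posD l n)) y by apply: fil_act_comm; exact: level_in.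
have Kc : FK (val (posD m n)) c by apply: fil_gcomm; exact: level_in.
have Kay : FK (val N) (gcomm (val a) y).
  have -> : val N = val m + val (posD l n) by rewrite /= addrCA.
  by apply: fil_gcomm => //; exact: level_in.
have Kxb : FK (val N) (gcomm x (val b)).
  have -> : val N = val (posD l m) + val n by rewrite /= addrA.
  by apply: fil_gcomm => //; exact: level_in.
(* The next three commutators have degrees [n + N], [m + N] and [l + N], all strictly above [N]. *)
have gt_yc : fil_gt FK (val N) (gcomm y c).
  apply: fil_gt_sub (fil_gcomm Ky Kc).
  have -> : val (posD l n) + val (posD m n) = val n + val N.
    by rewrite /= [sval l + _]addrC -addrA.
  exact: oltDl.
have gt_xc : fil_gt FK (val N) (gcomm x c).
  apply: fil_gt_sub (fil_gcomm Kx Kc).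
  have -> : val (posD l m) + val (posD m n) = val m + val N.
    by rewrite /= [sval l + _]addrC -addrA.
  exact: oltDl.
have gt_xy : fil_gt FK (val N) (gcomm x y).
  apply: fil_gt_sub (fil_gcomm Kx Ky).
  have -> : val (posD l m) + val (posD l n) = val l + val N.
    by rewrite /= -!addrA; congr (_ + _); rewrite addrCA.
  exact: oltDl.
have gt_rest : fil_gt FK (val N)
    ((x * gcomm y c * x^-1 * gcomm x c) * (c * gcomm x y * c^-1))%g.
  by apply: fil_gtM; first apply: fil_gtM => //; exact: fil_gtJ.
(* Conjugation by [c * y] is invisible in the graded quotient once this element has some positive
   degree; [n] bounds the degrees of both factors from below. *)
have Kcy : FK (val n) (c * y)%g.
  apply: filM.
    by apply: fil_le Kc; have /andP[] := oltDl n m.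
  by apply: fil_le Ky; have /andP[] := oltDl n l.
pose t1 : level FK (val N) := mk_level (filJ x Kay).
pose t2 : level FK (val N) := mk_level (fil_gtW gt_rest).
pose t3 : level FK (val N) := mk_level (filJ (c * y)%g Kxb).
have -> : level_act_comm actF g (level_br a b) = (t1 * t2 * t3)%g.
  by apply: val_inj; rewrite /= act_comm_gcomm.
(* Both Leibniz terms are moved to the common degree [N] by associativity and commutativity of
   [posD], so that they can be added there. *)
have -> : dsum_in (cls (level_br (level_act_comm actF g a) b)) =
    dsum_in (cls (mk_level Kxb : level FK (val N))).
  by apply: dsum_in_cls => //; rewrite -posDA.
have -> : dsum_in (cls (level_br a (level_act_comm actF g b))) =
    dsum_in (cls (mk_level Kay : level FK (val N))).
  by apply: dsum_in_cls => //; rewrite [RHS]posDA [posD l m]posDC -posDA.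
have t1E : cls t1 = cls (mk_level Kay : level FK (val N)) by exact: cls_conj Kx _.
have t3E : cls t3 = cls (mk_level Kxb : level FK (val N)) by exact: cls_conj Kcy _.
by rewrite 2!clsM t1E t3E (cls_eq0 (a := t2))// addr0 addrC raddfD.
Qed.

Definition tau g : Der (gr_lie FK) l :=
  der_of_components (gr_lie FK) l (tau_comp g) (tau_compD g) (tau_comp_br g).

Lemma tau_in g m (a : level FK (val m)) :
  tau g (@dsum_in _ (gr_lie FK) m (cls a)) =
    @dsum_in _ (gr_lie FK) (posD l m) (cls (level_act_comm actF g a)).
Proof.
rewrite -tau_compE; apply: (@dsum_map_in _ _ (gr_lie FK) (gr_lie FK) (posD l)).
exact: tau_compD.
Qed.

(** Derivations are additive, hence determined by their values on homogeneous elements, where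
    [cls_act_commMl] applies. *)
Lemma tauM g h : tau (g * h)%g = tau g + tau h.
Proof.
have der_0 (d : Der (gr_lie FK) l) : d 0 = 0.
  by apply: (addIr (d 0)); rewrite -derD !add0r.
apply: derP; elim/(@dsum_ind _ (gr_lie FK)) => [|f f' IH IH'|m x].
- by rewrite !der_0.
- by rewrite !derD IH IH'.
move: x; apply: cls_ind => a.
have -> (d d' : Der (gr_lie FK) l) z : (d + d') z = d z + d' z by [].
by rewrite !tau_in cls_act_commMl raddfD.
Qed.

End Tau.

Theorem proposition2p8 (Lam : goodMonoidType) (G K : groupType)
    (FG : filtration Lam G) (FK : filtration Lam K)
    (act : gaction G K) (actF : filtered_action FG FK act) (l : pos Lam) :
  exists tau : level FG (val l) -> Der (gr_lie FK) l,
    (forall g h : level FG (val l), tau (g * h)%g = tau g + tau h) /\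
    (forall (g : level FG (val l)) (m : pos Lam) (a : level FK (val m)),
       tau g (@dsum_in _ (gr_lie FK) m (cls a)) =
         @dsum_in _ (gr_lie FK) (posD l m) (cls (level_act_comm actF g a))).
Proof.
by exists (tau actF); split=> [g h|g m a]; [exact: tauM|exact: tau_in].
Qed.
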